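(* Let $M\ge1$ be an integer. The moment system $$\vec B_M^0(\vec W_M)\,\partial_t\vec W_M+\vec B_M^1(\vec W_M)\,\partial_x\vec W_M=\vec S(\vec W_M)$$ with Anderson–Witting source term $\vec S$ is Lorentz covariant: for every boost velocity $v\in(-1,1)$, under the Lorentz boost in the $x$-direction the system keeps the same form, i.e. if $\vec W_M(t,x)$ (with $\rho>0$, $|u|<1$, $\theta>0$) satisfies the system in the coordinates $(t,x)$, then the transformed vector $\vec W_M'$, as a function of $(t',x')$, satisfies $$\vec B_M^0(\vec W_M')\,\partial_{t'}\vec W_M'+\vec B_M^1(\vec W_M')\,\partial_{x'}\vec W_M'=\vec S(\vec W_M').$$
   Context: Units: speed of light and particle rest mass equal to $1$. **Lorentz boost.** For $v\in(-1,1)$ and $\gamma(v)=(1-v^2)^{-1/2}$: $t'=\gamma(v)(t-vx)$, $x'=\gamma(v)(x-vt)$. Correspondingly $(U^0)'=\gamma(v)(U^0-vU^1)$, $(U^1)'=\gamma(v)(U^1-vU^0)$, i.e. $u'=(u-v)/(1-uv)$, and all the other components $\rho,\theta,\Pi,\tilde n^1,f_k^0,f_k^1$ of $\vec W_M$ (defined below) are Lorentz invariant, so $\vec W_M'$ is $\vec W_M$ with $u$ replaced by $u'$ (evaluated at the same space-time point). Here $\tilde n^1=n^1\sqrt{1-u^2}$ with $n^1$ the spatial component of the particle-diffusion current. The relaxation time $\tau>0$ is a Lorentz scalar (it may depend on $\rho,\theta$). **Orthogonal polynomials.** For $\zeta>0$ let $K_n(\zeta)=\int_0^\infty\cosh(n\vartheta)e^{-\zeta\cosh\vartheta}d\vartheta$.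 For $\ell\in\{0,1\}$ let $\omega^{(\ell)}(x;\zeta)=K_1(\zeta)^{-1}(x^2-1)^{\ell-1/2}e^{-\zeta x}$ on $[1,\infty)$ and $(f,g)_{\omega^{(\ell)}}=\int_1^\infty fg\,\omega^{(\ell)}dx$. $\{P_n^{(\ell)}(x;\zeta)\}_{n\ge0}$ are the orthonormal polynomials for $(\cdot,\cdot)_{\omega^{(\ell)}}$ ($\deg P^{(\ell)}_n=n$, leading coefficient $c_n^{(\ell)}>0$); $P_n^{(\ell)}$ has $n$ simple zeros $1<x_{1,n}^{(\ell)}<\dots<x_{n,n}^{(\ell)}$. Put $a_n^{(\ell)}=c_n^{(\ell)}/c_{n+1}^{(\ell)}$, $b_n^{(\ell)}=(xP_n^{(\ell)},P_n^{(\ell)})_{\omega^{(\ell)}}$, $p_n=c_n^{(0)}/c_n^{(1)}$, $q_n=\frac{c_n^{(1)}}{c_{n+1}^{(0)}}\big(\sum_{i=1}^{n+2}x_{i,n+2}^{(0)}-\sum_{i=1}^nx_{i,n}^{(1)}\big)$, $r_n=c_{n-1}^{(1)}/c_{n+1}^{(0)}$ ($n\ge1$). **Matrices.** $\vec J_n^{(\ell)}$ is the $(n+1)\times(n+1)$ symmetric tridiagonal matrix with diagonal $b_0^{(\ell)},\dots,b_n^{(\ell)}$ and off-diagonal $a_0^{(\ell)},\dots,a_{n-1}^{(\ell)}$. $\vec J_{n}$ is the $(n+1)\times(n+2)$ matrix whose entries (rows $k=0,\dots,n$, columns $j=0,\dots,n+1$) are $p_k$ at $(k,k)$, $q_k$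 at $(k,k+1)$, $r_{k+1}$ at $(k,k+2)$ when $k+2\le n+1$, and $0$ otherwise. Define the $(2M+1)\times(2M+1)$ matrices $$\vec A_M^0=\begin{pmatrix}\vec J_M^{(0)}&0\\0&\vec J_{M-1}^{(1)}\end{pmatrix},\qquad \vec A_M^1=\begin{pmatrix}0&\vec J_{M-1}^T\\ \vec J_{M-1}&0\end{pmatrix}.$$ **Weighted basis.** For $|u|<1$, $\theta>0$ set $\zeta=1/\theta$, $U^0=(1-u^2)^{-1/2}$, $U^1=uU^0$; for $p\in\mathbb R$ set $p^0=\sqrt{1+p^2}$, $E=U^0p^0-U^1p$, $p_{<1>}=-p+U^1E$, $g_{[u,\theta]}=\frac1{2K_1(\zeta)}e^{-\zeta E}$. Let $\tilde P_k^{(0)}[u,\theta]=g_{[u,\theta]}P_k^{(0)}(E;\zeta)$, $\tilde P_k^{(1)}[u,\theta]=g_{[u,\theta]}P_k^{(1)}(E;\zeta)\,p_{<1>}/U^0$. Let $\vec{\mathcal P}_M=(\tilde P_0^{(0)},\tilde P_1^{(0)},\tilde P_0^{(1)},\tilde P_2^{(0)},\tilde P_1^{(1)},\dots,\tilde P_M^{(0)},\tilde P_{M-1}^{(1)})^T$; its components are orthonormal for $\langle f,h\rangle=\int_{\mathbb R}\frac{fh}{g_{[u,\theta]}}\frac{dp}{p^0}$. $\vec P_M^p$ is the permutation matrix with $\vec P_M^p(\tilde P_0^{(0)},\dots,\tilde P_M^{(0)},\tilde P_0^{(1)},\dots,\tilde P_{M-1}^{(1)})^T=\vec{\mathcal P}_M$.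 **Moment system (order $M$).** Unknowns: $\vec W_M=(\rho,u,\theta,\Pi,\tilde n^1,f_3^0,f_2^1,\dots,f_M^0,f_{M-1}^1)^T\in\mathbb R^{2M+1}$ ($\vec W_1=(\rho,u,\theta)^T$, $\vec W_2=(\rho,u,\theta,\Pi,\tilde n^1)^T$). To $\vec W_M$ associate $\vec f_M=(f_0^0,f_1^0,f_0^1,f_2^0,f_1^1,\dots,f_M^0,f_{M-1}^1)^T$: for $M=1$, $\vec f_1=(\rho/c_0^{(0)},0,0)^T$; for $M\ge2$, $f_0^0=\rho/c_0^{(0)}-c_0^{(0)}\Pi$, $f_1^0=c_1^{(0)}x_{1,1}^{(0)}\Pi$, $f_0^1=-c_0^{(1)}\tilde n^1$, $f_2^0=-c_2^{(0)}x_{1,2}^{(0)}x_{2,2}^{(0)}\Pi$, $f_1^1=c_1^{(1)}x_{1,1}^{(1)}\tilde n^1$ (all coefficients at $\zeta=1/\theta$), the remaining components being those of $\vec W_M$. Let $F(\vec W_M;p)=\vec{\mathcal P}_M[u,\theta]^T\vec f_M$. $\vec D_M=\vec D_M(\vec W_M)$ is the $(2M+1)\times(2M+1)$ matrix with $(\vec D_M)_{kj}=\langle\partial F/\partial W_j,(\vec{\mathcal P}_M)_k\rangle$ (the coefficients of the orthogonal projection of $\partial F/\partial W_j$ on the span of $\vec{\mathcal P}_M$). Further $$\vec M_M^t=\vec P_M^p(U^0\vec A_M^0-U^1\vec A_M^1)(\vec P_M^p)^T,\quad \vec M_M^x=\vec P_M^p(U^1\vec A_M^0-U^0\vec A_M^1)(\vec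 P_M^p)^T,$$ $\vec B_M^0=\vec M_M^t\vec D_M$, $\vec B_M^1=\vec M_M^x\vec D_M$, and the Anderson–Witting source is $$\vec S(\vec W_M)=-\frac1\tau\vec P_M^p\vec A_M^0(\vec P_M^p)^T\big(\vec f_M-\vec f_M^{(0)}\big),\qquad \vec f_M^{(0)}=(\rho/c_0^{(0)},0,\dots,0)^T.$$ *)

(* Defs.v *)
(* Units: the speed of light and the particle rest mass are 1. *)
From HB Require Import structures.
From mathcomp Require Import all_boot all_order all_algebra.
From mathcomp Require Import all_classical all_reals all_analysis.
From mathcomp Require Import polyrcf zify.

Set Implicit Arguments.
Unset Strict Implicit.
Unset Printing Implicit Defensive.

Import Order.TTheory GRing.Theory Num.Theory.
Import numFieldNormedType.Exports.

Local Open Scope classical_set_scope.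
Local Open Scope ring_scope.

Section OrthogonalPolynomials.
Context {R : realType}.
Implicit Types (z : R) (l n i : nat).

Definition cosh (x : R) : R := (expR x + expR (- x)) / 2.

Definition besselK n z : R :=
  \int[lebesgue_measure]_(s in `[0, +oo[) (cosh (n%:R * s) * expR (- (z * cosh s))).

Definition weight l z (x : R) : R :=
  (besselK 1 z)^-1 * ((x ^+ 2 - 1) `^ (l%:R - 2^-1)) * expR (- (z * x)).

Definition wdot l z (f g : R -> R) : R :=
  \int[lebesgue_measure]_(x in `[1, +oo[) (f x * g x * weight l z x).

Definition orthonormal_polys l z (P : nat -> {poly R}) : Prop :=
  (forall n, size (P n) = n.+1 /\ 0 < lead_coef (P n)) /\
  (forall m n, wdot l z (horner (P m)) (horner (P n)) = (m == n)%:R).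

(* For l = 0, 1 and z > 0 there is exactly one such family; [xget] names it,
   the constant family 0 being its default value for other parameters. *)
Definition opoly l z : nat -> {poly R} :=
  xget (fun=> 0) [set P | orthonormal_polys l z P].

Definition lc l z n : R := lead_coef (opoly l z n).

(* [zero l z n i], 1 <= i <= n, is the i-th zero of [opoly l z n] in increasing
   order: [rootsR] is the increasing list of the real roots. *)
Definition zero l z n i : R := nth 0 (rootsR (opoly l z n)) i.-1.

Definition coef_a l z n : R := lc l z n / lc l z n.+1.
Definition coef_b l z n : R :=
  wdot l z (fun x => x * (opoly l z n).[x]) (horner (opoly l z n)).
Definition coef_p z n : R := lc 0 z n / lc 1 z n.
Definition coef_q z n : R :=
  lc 1 z n / lc 0 z n.+1 *
  (\sum_(1 <= i < n.+3) zero 0 z n.+2 i - \sum_(1 <= i < n.+1) zero 1 z n i).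
(* Only used for n >= 1. *)
Definition coef_r z n : R := lc 1 z n.-1 / lc 0 z n.+1.

(* The Jacobi matrix of size n, whose diagonal is b_0, ..., b_(n-1). *)
Definition jacobi l z n : 'M[R]_n :=
  \matrix_(i, j)
    if i == j :> nat then coef_b l z i
    else if j == i.+1 :> nat then coef_a l z i
    else if i == j.+1 :> nat then coef_a l z j
    else 0.

(* The coupling matrix with n rows (indexed by 0, ..., n-1). *)
Definition coupling z n : 'M[R]_(n, n.+1) :=
  \matrix_(k, j)
    if j == k :> nat then coef_p z k
    else if j == k.+1 :> nat then coef_q z k
    else if j == k.+2 :> nat then coef_r z k.+1
    else 0.

End OrthogonalPolynomials.

(* 2M+1, in the form of the sizes of the two diagonal blocks of [A0]. *)
Notation dimW M := (M.+1 + M)%N.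

(* A pair (l, k) stands for the moment of type l and degree k.  [slot i] is the
   i-th one in the order (0,0), (0,1), (1,0), (0,2), (1,1), ..., (0,M), (1,M-1)
   of the unknowns, [block_slot M i] the i-th one in the order
   (0,0), ..., (0,M), (1,0), ..., (1,M-1). *)
Definition slot (i : nat) : nat * nat :=
  if i == 0%N then (0%N, 0%N)
  else if odd i then (0%N, uphalf i) else (1%N, i./2.-1).

Definition block_slot (M i : nat) : nat * nat :=
  if (i <= M)%N then (0%N, i) else (1%N, (i - M.+1)%N).

Lemma block_slot_inj M : injective (block_slot M).
Proof.
move=> i j; rewrite /block_slot.
case: (leqP i M) => iM; case: (leqP j M) => jM /= [] //.
by move=> e; lia.
Qed.

Lemma slot_block M i : (i < dimW M)%N ->
  exists k : 'I_(dimW M), slot i = block_slot M k.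
Proof.
move=> iM; rewrite /slot /block_slot.
have [_|i0] := eqVneq i 0%N; first by exists ord0.
case: ifP => oi.
- have h : (uphalf i < dimW M)%N by lia.
  by exists (Ordinal h) => /=; rewrite ifT//; lia.
- have h : (M.+1 + i./2.-1 < dimW M)%N by lia.
  exists (Ordinal h) => /=; rewrite ifF; last by lia.
  by congr pair; lia.
Qed.

Section MomentSystem.
Context {R : realType}.
Implicit Types (M : nat) (z v u theta p : R).

Definition A0 M z : 'M[R]_(dimW M) :=
  block_mx (jacobi 0 z M.+1) 0 0 (jacobi 1 z M).

Definition A1 M z : 'M[R]_(dimW M) :=
  block_mx 0 (coupling z M)^T (coupling z M) 0.

(* The permutation matrix from the order [block_slot] to the order [slot]. *)
Definition Pp M : 'M[R]_(dimW M) :=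
  \matrix_(i, j) (slot i == block_slot M j)%:R.

Definition gam v : R := (Num.sqrt (1 - v ^+ 2))^-1.

Definition U0 u : R := gam u.
Definition U1 u : R := u * U0 u.

Definition p0 p : R := Num.sqrt (1 + p ^+ 2).
Definition energy u p : R := U0 u * p0 p - U1 u * p.
Definition pbra u p : R := - p + U1 u * energy u p.

Definition geq u theta p : R :=
  (2 * besselK 1 theta^-1)^-1 * expR (- (theta^-1 * energy u p)).

Definition tP0 u theta k p : R :=
  geq u theta p * (opoly 0 theta^-1 k).[energy u p].
Definition tP1 u theta k p : R :=
  geq u theta p * (opoly 1 theta^-1 k).[energy u p] * (pbra u p / U0 u).
Definition tP u theta (s : nat * nat) p : R :=
  if s.1 == 0%N then tP0 u theta s.2 p else tP1 u theta s.2 p.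

Definition basis M u theta p : 'cV[R]_(dimW M) :=
  \col_i tP u theta (slot i) p.
Definition block_basis M u theta p : 'cV[R]_(dimW M) :=
  \col_i tP u theta (block_slot M i) p.

Lemma Pp_basis M u theta p :
  Pp M *m block_basis M u theta p = basis M u theta p.
Proof.
apply/matrixP => i j; rewrite !mxE.
have [k ki] := slot_block (ltn_ord i).
rewrite (bigD1 k)//= !mxE ki eqxx mul1r big1 ?addr0// => h hk.
rewrite !mxE; case: eqP => [e|_]; last by rewrite mul0r.
by case/eqP: hk; apply/val_inj; apply: (@block_slot_inj M); rewrite -e ki.
Qed.

Definition inner u theta (f h : R -> R) : R :=
  \int[lebesgue_measure]_(p in setT) (f p * h p / geq u theta p / p0 p).

Section Coordinates.
Variable M : nat.
Implicit Type W : 'cV[R]_(dimW M).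

(* Only used for k < 2M+1, where [inord k] has value k. *)
Definition coord W (k : nat) : R := W (inord k) 0.

Definition rho W := coord W 0.
Definition vel W := coord W 1.
Definition temp W := coord W 2.
Definition bulk W := coord W 3.
Definition diffusion W := coord W 4.

Definition admissible W : Prop :=
  [/\ 0 < rho W, `|vel W| < 1 & 0 < temp W].

Definition coefs_eq W : 'cV[R]_(dimW M) :=
  \col_i if i == 0%N :> nat then rho W / lc 0 (temp W)^-1 0 else 0.

Definition coefs W : 'cV[R]_(dimW M) :=
  let z := (temp W)^-1 in
  if (M <= 1)%N then
    \col_i if i == 0%N :> nat then rho W / lc 0 z 0 else 0
  else
    \col_i match i : nat with
           | 0 => rho W / lc 0 z 0 - lc 0 z 0 * bulk W
           | 1 => lc 0 z 1 * zero 0 z 1 1 * bulk W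
           | 2 => - (lc 1 z 0 * diffusion W)
           | 3 => - (lc 0 z 2 * zero 0 z 2 1 * zero 0 z 2 2 * bulk W)
           | 4 => lc 1 z 1 * zero 1 z 1 1 * diffusion W
           | _ => W i 0
           end.

Definition dist W p : R :=
  ((basis M (vel W) (temp W) p)^T *m coefs W) 0 0.

Definition Dmx W : 'M[R]_(dimW M) :=
  \matrix_(k, j)
    inner (vel W) (temp W)
      (fun p => 'D_(delta_mx j 0) (fun W' : 'cV[R]_(dimW M) => dist W' p) W)
      (fun p => basis M (vel W) (temp W) p k 0).

Definition Mt W : 'M[R]_(dimW M) :=
  let z := (temp W)^-1 in
  Pp M *m (U0 (vel W) *: A0 M z - U1 (vel W) *: A1 M z) *m (Pp M)^T.

Definition Mx W : 'M[R]_(dimW M) :=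
  let z := (temp W)^-1 in
  Pp M *m (U1 (vel W) *: A0 M z - U0 (vel W) *: A1 M z) *m (Pp M)^T.

Definition B0 W : 'M[R]_(dimW M) := Mt W *m Dmx W.
Definition B1 W : 'M[R]_(dimW M) := Mx W *m Dmx W.

(* The relaxation time is a function of rho and theta. *)
Definition source (tau : R -> R -> R) W : 'cV[R]_(dimW M) :=
  - (tau (rho W) (temp W))^-1 *:
  (Pp M *m A0 M (temp W)^-1 *m (Pp M)^T *m (coefs W - coefs_eq W)).

(* A classical solution on an open set of space-time points (t, x). *)
Definition solution (tau : R -> R -> R) (Omega : set (R * R))
    (W : R * R -> 'cV[R]_(dimW M)) : Prop :=
  open Omega /\
  forall y, Omega y ->
  [/\ admissible (W y), differentiable W y &
      B0 (W y) *m 'D_(1, 0) W y + B1 (W y) *m 'D_(0, 1) W y = source tau (W y)].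

Definition boost v (y : R * R) : R * R :=
  (gam v * (y.1 - v * y.2), gam v * (y.2 - v * y.1)).

Definition boost_state v W : 'cV[R]_(dimW M) :=
  \col_i if i == 1%N :> nat then (vel W - v) / (1 - vel W * v) else W i 0.

End Coordinates.

End MomentSystem.

(* Main.v *)
Require Import Defs.
From HB Require Import structures.
From mathcomp Require Import all_boot all_order all_algebra.
From mathcomp Require Import all_classical all_reals all_analysis.
From mathcomp Require Import measurable_realfun.
From mathcomp Require Import ring lra.

Set Implicit Arguments.
Unset Strict Implicit.
Unset Printing Implicit Defensive.

Import Order.TTheory GRing.Theory Num.Theory.
Import numFieldNormedType.Exports.

Local Open Scope classical_set_scope.
Local Open Scope ring_scope.

(** A boost acts on three things at once: on space-time points, on the velocity
   [u], by u' = (u - v) / (1 - u v) ([boost_vel]), and on the momentum variable,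
   by p' = gamma (p - v p^0) ([boost_mom]).  The energy E and the rest-frame
   momentum p_<1> / U^0 seen by an observer of velocity [u] do not change when
   [u] and [p] are both boosted, so every basis function satisfies
   P~[u', theta](p') = P~[u, theta](p) ([tP_boost]); since the coefficients f_M
   do not involve [u], the distribution satisfies F(W'; p') = F(W; p)
   ([dist_boost]).

   Differentiating this identity in [W] gives (dF/dW_j)(W; p) = J_j
   (dF/dW_j)(W'; p'), where the diagonal matrix J ([jac]) is the Jacobian of
   W |-> W' ([derive_dist_boost]). For j <> u both derivatives are limits of
   the same difference quotients, because a variation of W_j commutes with
   the boost; this spares a study of how the orthogonal polynomials depend on
   theta. For j = u it is the chain rule in one real variable, F being smooth
   in [u]. As the measure dp / p^0 is invariant under p |-> p', integration
   against the basis functions yields D_M(W) = D_M(W') J ([Dmx_boost]). Where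
   the theta-derivative does not exist nothing is known of the measurability
   of the integrand, so the change of variables is established for arbitrary
   real functions ([Rintegral_change_of_variables]).

   On the space-time side W' = (W |-> W') o W o (inverse boost), whence
   d_t' W' = gamma J (d_t W + v d_x W) and d_x' W' = gamma J (v d_t W + d_x W).
   The coefficients of A^0 and A^1 in M^t and M^x are, up to sign, components of
   the two-velocity, so that gamma (M^t(W') + v M^x(W')) = M^t(W) and
   gamma (v M^t(W') + M^x(W')) = M^x(W) ([covariant_Mt], [covariant_Mx]).
   Multiplying these together, J is absorbed by D_M(W') and the left-hand side
   of the system at W' becomes that at W; the source involves Lorentz scalars
   only ([source_boost]). *)

(** * Change of variables for arbitrary functions *)

Section ChangeOfVariables.
Context {R : realType}.
Local Notation mu := (@lebesgue_measure R).

Import HBNNSimple.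

Section Density.
Variables (phi psi dphi : R -> R).
Hypotheses (psiK : cancel psi phi)
  (phi_lt : {mono phi : x y / x < y}) (cdphi : continuous dphi)
  (dphi_ge0 : forall x : R, 0 <= dphi x)
  (phi_der : forall x : R, is_derive x 1 phi (dphi x)).

Let mphi : measurable_fun setT (phi : measurableTypeR R -> measurableTypeR R).
Proof.
apply: continuous_measurable_fun => x.
apply/differentiable_continuous/derivable1_diffP.
by have [] := phi_der x.
Qed.

Let mdphi : measurable_fun setT dphi.
Proof. exact: continuous_measurable_fun. Qed.

Let mpreim (A : set (measurableTypeR R)) :
  measurable A -> measurable (phi @^-1` A : set (measurableTypeR R)).
Proof. by move=> mA; rewrite -[X in measurable X]setTI; exact: mphi. Qed.

Definition image_measure (A : set (measurableTypeR R)) : \bar R :=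
  (\int[mu]_(x in phi @^-1` A) (dphi x)%:E)%E.

Let image_measure0 : image_measure set0 = 0%E.
Proof. by rewrite /image_measure preimage_set0 integral_set0. Qed.

Let image_measure_ge0 A : (0 <= image_measure A)%E.
Proof. by apply: integral_ge0 => x _; rewrite lee_fin. Qed.

Let image_measure_sigma_additive : semi_sigma_additive image_measure.
Proof.
move=> F mF tF mUF; rewrite /image_measure preimage_bigcup.
rewrite ge0_integral_bigcup//=.
- by apply: is_cvg_ereal_nneg_natsum => n _; exact: image_measure_ge0.
- by move=> n; exact: mpreim.
- by apply/measurable_EFinP; apply: measurable_funTS.
- by move=> x _; rewrite lee_fin.
- apply/trivIsetP => i j _ _ ij; rewrite -preimage_setI.
  by move/trivIsetP : tF => /(_ _ _ _ _ ij) ->//; rewrite preimage_set0.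
Qed.

HB.instance Definition _ := isMeasure.Build _ _ _ image_measure
  image_measure0 image_measure_ge0 image_measure_sigma_additive.

Let preim_oc (a b : R) : phi @^-1` `]a, b] = `]psi a, psi b]%classic.
Proof.
have phi_le x y : (phi x <= phi y) = (x <= y) by rewrite !leNgt phi_lt.
apply/seteqP; split => x /=; rewrite !in_itv/=.
  by rewrite -{1}[a]psiK -{1}[b]psiK phi_lt phi_le.
by rewrite -{2}[a]psiK -{2}[b]psiK phi_lt phi_le.
Qed.

(** By the fundamental theorem of calculus the two measures agree on the
    intervals ]a, b], whose preimages are ]psi a, psi b]. *)
Lemma lebesgue_image_measure A : measurable A -> mu A = image_measure A.
Proof.
move=> mA; apply: lebesgue_measure_unique => // _ [[a b]] _ <-/=.
rewrite /image_measure lebesgue_measure_itv/= preim_oc lte_fin.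
have [ab|ba] := ltP a b; last first.
  rewrite set_itv_ge ?integral_set0//.
  by rewrite bnd_simp -phi_lt !psiK -leNgt.
have psiab : psi a < psi b by rewrite -phi_lt !psiK.
rewrite integral_itv_obnd_cbnd; last first.
  by apply/measurable_EFinP; apply: measurable_funTS.
have cphi : continuous phi.
  move=> x; apply/differentiable_continuous/derivable1_diffP.
  by have [] := phi_der x.
rewrite (@continuous_FTC2 _ _ phi)// ?psiK//.
- exact: continuous_subspaceT.
- split.
  + by move=> x _; have [] := phi_der x.
  + by apply: cvg_at_right_filter; exact: cphi.
  + by apply: cvg_at_left_filter; exact: cphi.
- by move=> x _; rewrite derive1E; have [_] := phi_der x.
Qed.

Let simple_change_of_variables (h : {nnsfun (measurableTypeR R) >-> R}) :
  (\int[mu]_x (h x)%:E = \int[mu]_x (h (phi x) * dphi x)%:E)%E.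
Proof.
transitivity (\int[mu]_x \sum_(r \in range h)
    ((dphi x)%:E * (r * \1_(h @^-1` [set r]) (phi x))%:E))%E; last first.
  apply: eq_integral => x _; rewrite fimfunE EFinM -fsumEFin// muleC.
  by rewrite ge0_mule_fsumr// => r; rewrite EFinM nnfun_muleindic_ge0.
rewrite ge0_integral_fsum//; last 2 first.
- move=> r; apply: emeasurable_funM; first exact/measurable_EFinP.
  apply/measurable_EFinP/measurable_funM => //.
  apply: (measurableT_comp (measurable_indic _)) => //.
- move=> r x _; rewrite mule_ge0 ?lee_fin// -lee_fin EFinM.
  exact: nnfun_muleindic_ge0.
rewrite integralT_nnsfun sintegralE.
apply: eq_fsbigr => r.
rewrite inE => -[y _ <-].
transitivity ((h y)%:E * image_measure (h @^-1` [set h y]))%E.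
  by congr (_ * _)%E; exact: lebesgue_image_measure.
rewrite /image_measure.
have mhr :
    measurable (phi @^-1` (h @^-1` [set h y]) : set (measurableTypeR R)).
  exact: mpreim.
rewrite -ge0_integralZl//.
- rewrite integral_mkcond; apply: eq_integral => x _; rewrite patchE indicE.
  have -> : (x \in phi @^-1` (h @^-1` [set h y])) =
    (phi x \in h @^-1` [set h y]) by [].
  by case: (phi x \in _) => /=; rewrite ?mulr1 ?mulr0 ?mule0// muleC.
- by apply/measurable_EFinP; exact: measurable_funTS.
- by move=> x _; rewrite lee_fin.
- by rewrite lee_fin.
Qed.

(** The integral of a nonnegative function, measurable or not, is the supremum
    of the integrals of the simple functions below it; transporting these
    simple functions gives one inequality. *)
Lemma le_change_of_variables (f : R -> \bar R) : (forall x, 0 <= f x)%E ->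
  (\int[mu]_x f x <= \int[mu]_x (f (phi x) * (dphi x)%:E))%E.
Proof.
move=> f0; rewrite ge0_integralTE//; apply: ge_ereal_sup => /= _ [h hf <-].
rewrite -integralT_nnsfun simple_change_of_variables.
rewrite !ge0_integralTE; last 2 first.
- by move=> x; rewrite mule_ge0// lee_fin.
- by move=> x; rewrite lee_fin mulr_ge0.
apply: ge_ereal_sup => /= _ [g hg <-].
apply: ereal_sup_ubound; exists g => //= x.
by rewrite (le_trans (hg x))// EFinM lee_wpmul2r ?lee_fin.
Qed.
End Density.

Section Bijection.
Variables (phi psi dphi dpsi : R -> R).
Hypotheses (phiK : cancel phi psi) (psiK : cancel psi phi)
  (phi_lt : {mono phi : x y / x < y})
  (cdphi : continuous dphi) (cdpsi : continuous dpsi)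
  (dphi_ge0 : forall x : R, 0 <= dphi x) (dpsi_ge0 : forall x : R, 0 <= dpsi x)
  (phi_der : forall x : R, is_derive x 1 phi (dphi x))
  (psi_der : forall x : R, is_derive x 1 psi (dpsi x)).

(** The reverse inequality is [le_change_of_variables] for the inverse
    bijection, applied to the function (f o phi) * dphi. *)
Lemma ge0_change_of_variables (f : R -> \bar R) : (forall x, 0 <= f x)%E ->
  (\int[mu]_x f x = \int[mu]_x (f (phi x) * (dphi x)%:E))%E.
Proof.
have psi_lt : {mono psi : x y / x < y}.
  by move=> x y; rewrite -phi_lt !psiK.
have dpsiK x : dphi (psi x) * dpsi x = 1.
  have := is_derive1_comp (phi_der (psi x)) (psi_der x).
  have -> : phi \o psi = id by apply/funext => y; exact: psiK.
  by move=> [_ <-]; rewrite derive_id.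
move=> f0; apply/eqP; rewrite eq_le (le_change_of_variables psiK phi_lt)//=.
apply: le_trans (le_change_of_variables phiK psi_lt cdpsi _ _ _) _ => //.
  by move=> x; rewrite mule_ge0 ?lee_fin.
rewrite le_eqVlt; apply/orP; left; apply/eqP; apply: eq_integral => x _.
by rewrite psiK -muleA -EFinM dpsiK mule1.
Qed.

Lemma Rintegral_change_of_variables (f : R -> R) :
  \int[mu]_x f x = \int[mu]_x (f (phi x) * dphi x).
Proof.
rewrite /Rintegral; congr fine; rewrite integralE [RHS]integralE.
rewrite (ge0_change_of_variables (f := (fun x => (f x)%:E)^\+)%E)//.
rewrite (ge0_change_of_variables (f := (fun x => (f x)%:E)^\-)%E)//.
congr (_ - _)%E; apply: eq_integral => x _.
  by rewrite !funeposE EFinM maxe_pMl ?lee_fin// mul0e.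
by rewrite !funenegE EFinM -mulNe maxe_pMl ?lee_fin// mul0e.
Qed.
End Bijection.

(** As for the change of variables, a positive factor can be taken out of the
    integral of an arbitrary function by comparing simple functions. *)
Lemma ge0_integral_scale_le (c : R) (f : R -> \bar R) : 0 < c ->
  (forall x, 0 <= f x)%E ->
  (c%:E * \int[mu]_x f x <= \int[mu]_x (c%:E * f x))%E.
Proof.
move=> c0 f0; rewrite -lee_pdivlMl// ge0_integralTE//.
apply: ge_ereal_sup => /= _ [h hf <-].
rewrite lee_pdivlMl// -integralT_nnsfun -ge0_integralZl//; last 3 first.
- exact/measurable_EFinP.
- by move=> x _; rewrite lee_fin.
- by rewrite lee_fin ltW.
rewrite !ge0_integralTE; last 2 first.
- by move=> x; rewrite mule_ge0// lee_fin ltW.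
- by move=> x; rewrite mule_ge0// lee_fin// ltW.
apply: ge_ereal_sup => /= _ [g hg <-].
apply: ereal_sup_ubound; exists g => //= x.
by rewrite (le_trans (hg x))// lee_pmul2l.
Qed.

Lemma ge0_integral_scale (c : R) (f : R -> \bar R) : 0 < c ->
  (forall x, 0 <= f x)%E ->
  (\int[mu]_x (c%:E * f x) = c%:E * \int[mu]_x f x)%E.
Proof.
move=> c0 f0; apply/eqP; rewrite eq_le ge0_integral_scale_le// andbT.
rewrite -lee_pdivrMl//.
apply: le_trans (ge0_integral_scale_le _ _) _; rewrite ?invr_gt0//.
  by move=> x; rewrite mule_ge0// lee_fin ltW.
rewrite le_eqVlt; apply/orP; left; apply/eqP; apply: eq_integral => x _.
by rewrite muleA -EFinM mulVf ?mul1e// gt_eqF.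
Qed.

Lemma Rintegral_scale (c : R) (f : R -> R) : 0 < c ->
  \int[mu]_x (c * f x) = c * \int[mu]_x f x.
Proof.
move=> c0; rewrite /Rintegral.
have -> : (\int[mu]_x (c * f x)%:E = c%:E * \int[mu]_x (f x)%:E)%E.
  rewrite integralE [in RHS]integralE.
  (* Distributivity holds even for +oo - +oo, which is -oo by convention,
     because [c] is positive. *)
  have muleB (a b : \bar R) : (c%:E * (a - b) = c%:E * a - c%:E * b)%E.
    case: a b => [a| |] [b| |] //=; rewrite ?gt0_muley ?gt0_muleNy ?lte_fin//=.
    by rewrite -EFinD -!EFinM -EFinD mulrBr.
  rewrite muleB -!ge0_integral_scale//.
  congr (_ - _)%E; apply: eq_integral => x _.
    by rewrite !funeposE EFinM -[in LHS](mule0 c%:E) maxe_pMr ?lee_fin// ltW.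
  rewrite !funenegE EFinM -muleN -[in LHS](mule0 c%:E).
  by rewrite maxe_pMr ?lee_fin// ltW.
case: (integral _ _ _) => [r| |]; first by [].
  by rewrite gt0_muley ?lte_fin//= mulr0.
by rewrite gt0_muleNy ?lte_fin//= mulr0.
Qed.
End ChangeOfVariables.

(** * Boosts of velocities and momenta *)

Section Kinematics.
Context {R : realType}.
Implicit Types (u v p theta : R).

Definition boost_vel v u : R := (u - v) / (1 - u * v).
Definition boost_mom v p : R := gam v * (p - v * p0 p).

Lemma one_minus_sqr_gt0 v : `|v| < 1 -> 0 < 1 - v ^+ 2.
Proof. by rewrite subr_gt0 -real_normK ?num_real// expr_lt1. Qed.

Lemma one_minus_mul_gt0 u v : `|u| < 1 -> `|v| < 1 -> 0 < 1 - u * v.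
Proof.
by rewrite !ltr_norml => /andP[? ?] /andP[? ?]; nra.
Qed.

Lemma gam_gt0 v : `|v| < 1 -> 0 < gam v.
Proof. by move=> v1; rewrite invr_gt0 sqrtr_gt0 one_minus_sqr_gt0. Qed.

Lemma gam_sqr v : `|v| < 1 -> gam v ^+ 2 * (1 - v ^+ 2) = 1.
Proof.
move=> v1; have v0 := one_minus_sqr_gt0 v1.
by rewrite exprVn sqr_sqrtr ?mulVf ?gt_eqF// ltW.
Qed.

(** [gam_sqr] solved for its leading monomial, the form in which [ring] can use
    it as a rewriting rule. *)
Lemma sqr_mul_gam v : `|v| < 1 -> v ^+ 2 * gam v ^+ 2 = gam v ^+ 2 - 1.
Proof. by move/gam_sqr => <-; ring. Qed.

Lemma gamN v : gam (- v) = gam v.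
Proof. by rewrite /gam sqrrN. Qed.

Lemma p0_sqr p : p0 p ^+ 2 = 1 + p ^+ 2.
Proof. by rewrite sqr_sqrtr// addr_ge0// sqr_ge0. Qed.

Lemma p0_gt0 p : 0 < p0 p.
Proof. by rewrite sqrtr_gt0 ltr_wpDr// sqr_ge0. Qed.

Lemma norm_lt_p0 p : `|p| < p0 p.
Proof.
rewrite -(ltr_pXn2r (n := 2))// ?nnegrE ?normr_ge0 ?ltW ?p0_gt0//.
by rewrite p0_sqr real_normK ?num_real// ltrDr.
Qed.

Lemma p0_minus_gt0 v p : `|v| < 1 -> 0 < p0 p - v * p.
Proof.
move=> v1; rewrite subr_gt0 (le_lt_trans (ler_norm _))// normrM.
have := norm_lt_p0 p; have := p0_gt0 p; have := normr_ge0 p.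
have := normr_ge0 v; nra.
Qed.

Lemma p0_boost v p : `|v| < 1 -> p0 (boost_mom v p) = gam v * (p0 p - v * p).
Proof.
move=> v1; rewrite /p0.
have -> : 1 + boost_mom v p ^+ 2 = (gam v * (p0 p - v * p)) ^+ 2.
  rewrite /boost_mom; have g := sqr_mul_gam v1; have h := p0_sqr p.
  ring: g h.
by rewrite sqrtr_sqr gtr0_norm// mulr_gt0 ?gam_gt0 ?p0_minus_gt0.
Qed.

Lemma boost_momK v : `|v| < 1 -> cancel (boost_mom v) (boost_mom (- v)).
Proof.
move=> v1 p; rewrite {1}/boost_mom p0_boost// gamN /boost_mom.
have g := sqr_mul_gam v1; ring: g.
Qed.

Lemma gam_boost_vel u v : `|u| < 1 -> `|v| < 1 ->
  gam (boost_vel v u) = gam v * gam u * (1 - u * v).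
Proof.
move=> u1 v1; have uv := one_minus_mul_gt0 u1 v1.
have uv0 : 1 - u * v != 0 by rewrite gt_eqF.
rewrite /gam.
have -> : 1 - boost_vel v u ^+ 2 =
    (1 - v ^+ 2) * ((1 - u ^+ 2) / (1 - u * v) ^+ 2).
  by rewrite /boost_vel; field.
rewrite sqrtrM ?ltW ?one_minus_sqr_gt0// sqrtrM ?ltW ?one_minus_sqr_gt0//.
by rewrite sqrtrV ?sqr_ge0// sqrtr_sqr gtr0_norm// !invfM invrK mulrA.
Qed.

Lemma boost_vel_lt1 u v : `|u| < 1 -> `|v| < 1 -> `|boost_vel v u| < 1.
Proof.
move=> u1 v1; have uv := one_minus_mul_gt0 u1 v1.
rewrite /boost_vel normrM normfV (gtr0_norm uv) ltr_pdivrMr// mul1r.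
by move: u1 v1; rewrite !ltr_norml => /andP[? ?] /andP[? ?]; nra.
Qed.

Lemma energy_boost u v p : `|u| < 1 -> `|v| < 1 ->
  energy (boost_vel v u) (boost_mom v p) = energy u p.
Proof.
move=> u1 v1; rewrite /energy /U1 /U0 p0_boost// gam_boost_vel//.
rewrite /boost_mom /boost_vel; have uv := one_minus_mul_gt0 u1 v1.
have g := gam_sqr v1.
have uv0 : 1 - u * v != 0 by rewrite gt_eqF.
transitivity (gam u * (gam v ^+ 2 * (1 - v ^+ 2)) * (p0 p - u * p)).
  by field.
by rewrite g; ring.
Qed.

(** Up to sign, p_<1> / U^0 is the momentum in the rest frame of the fluid;
    this is why it does not depend on the observer. *)
Lemma pbra_rest u p : `|u| < 1 -> pbra u p / U0 u = U1 u * p0 p - U0 u * p.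
Proof.
move=> u1; have g := sqr_mul_gam u1; have g0 := gam_gt0 u1.
rewrite /pbra /energy /U1 /U0.
have g0' : gam u != 0 by rewrite gt_eqF.
apply: (mulIf g0'); rewrite divfK//; ring: g.
Qed.

Lemma pbra_boost u v p : `|u| < 1 -> `|v| < 1 ->
  pbra (boost_vel v u) (boost_mom v p) / U0 (boost_vel v u) = pbra u p / U0 u.
Proof.
move=> u1 v1; rewrite !pbra_rest ?boost_vel_lt1//.
rewrite /U1 /U0 p0_boost// gam_boost_vel//.
rewrite /boost_mom /boost_vel; have uv := one_minus_mul_gt0 u1 v1.
have g := gam_sqr v1.
have uv0 : 1 - u * v != 0 by rewrite gt_eqF.
transitivity (gam u * (gam v ^+ 2 * (1 - v ^+ 2)) * (u * p0 p - p)).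
  by field.
by rewrite g; ring.
Qed.

Lemma geq_boost u v theta p : `|u| < 1 -> `|v| < 1 ->
  Defs.geq (boost_vel v u) theta (boost_mom v p) = Defs.geq u theta p.
Proof. by move=> u1 v1; rewrite /Defs.geq energy_boost. Qed.

Lemma tP_boost u v theta s p : `|u| < 1 -> `|v| < 1 ->
  tP (boost_vel v u) theta s (boost_mom v p) = tP u theta s p.
Proof.
by move=> u1 v1; rewrite /tP /tP0 /tP1 geq_boost// energy_boost// pbra_boost.
Qed.

Lemma is_derive_p0 p : is_derive p 1 p0 (p / p0 p).
Proof.
have pp : 0 < 1 + p ^+ 2 by rewrite ltr_wpDr// sqr_ge0.
have h : is_derive p 1 (fun q : R => 1 + q ^+ 2) (2 * p).
  by apply: is_derive_eq; rewrite /GRing.scale/=; ring.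
have s := is_derive1_sqrt pp.
have := @is_derive1_comp _ _ (fun q => 1 + q ^+ 2) p _ _ s h; rewrite -/(p0 p).
have -> : (2 * p0 p)^-1 * (2 * p) = p / p0 p.
  by have := p0_gt0 p => /lt0r_neq0 ?; field.
by [].
Qed.

Lemma continuous_p0 : continuous (@p0 R).
Proof.
move=> p; apply/differentiable_continuous/derivable1_diffP.
by have [] := is_derive_p0 p.
Qed.

(** This derivative says that dp' / p'^0 = dp / p^0. *)
Lemma is_derive_boost_mom v p : `|v| < 1 ->
  is_derive p 1 (boost_mom v) (p0 (boost_mom v p) / p0 p).
Proof.
move=> v1; rewrite (p0_boost _ v1).
have -> : gam v * (p0 p - v * p) / p0 p = gam v *: (1 - v *: (p / p0 p)).
  by have := p0_gt0 p => /lt0r_neq0 ?; rewrite /GRing.scale/=; field.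
apply: is_deriveZ; apply: is_deriveB; apply: is_deriveZ.
exact: is_derive_p0.
Qed.

(** Since |v| < 1, it suffices that p^0 is a strict contraction of [p]. *)
Lemma boost_mom_lt v : `|v| < 1 -> {mono boost_mom v : p q / p < q}.
Proof.
move=> v1; apply: leW_mono; apply: le_mono => p q pq.
rewrite /boost_mom ltr_pM2l ?gam_gt0//.
suff : `|p0 q - p0 p| < q - p.
  move=> h; rewrite ltrBlDr -ltrBlDl.
  have : v * p0 q - v * p0 p <= `|p0 q - p0 p|.
    rewrite -mulrBr (le_trans (ler_norm _))// normrM ler_piMl// ltW//.
  by lra.
have h : (p0 q - p0 p) * (p0 q + p0 p) = (q - p) * (q + p).
  have := p0_sqr p; have := p0_sqr q; lra.
have pp : 0 < p0 q + p0 p by rewrite addr_gt0// p0_gt0.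
rewrite -(ltr_pM2r pp) -{1}(gtr0_norm pp) -normrM h normrM.
rewrite gtr0_norm ?subr_gt0//.
rewrite ltr_pM2l ?subr_gt0//.
by rewrite (le_lt_trans (ler_normD _ _))// ltrD// norm_lt_p0.
Qed.

End Kinematics.

(** * Invariant measure and dependence on the velocity *)

Section Invariant.
Context {R : realType}.
Implicit Types (u v p theta : R).

(** Invariance of the measure dp / p^0. *)
Lemma Rintegral_boost v (f : R -> R) : `|v| < 1 ->
  \int[lebesgue_measure]_p (f (boost_mom v p) / p0 p) =
  \int[lebesgue_measure]_p (f p / p0 p).
Proof.
have cfactor w : `|w| < 1 ->
    continuous (fun p : R => p0 (boost_mom w p) / p0 p).
  move=> w1 p; apply: (@cvgM R _ (nbhs p)).
    apply: continuous_comp; last exact: continuous_p0.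
    apply/differentiable_continuous/derivable1_diffP.
    by have [] := is_derive_boost_mom p w1.
  apply: cvgV; first by rewrite gt_eqF// p0_gt0.
  exact: continuous_p0.
have factor_ge0 w p : 0 <= p0 (boost_mom w p) / p0 p.
  by rewrite divr_ge0// ltW// p0_gt0.
move=> v1; have v1N : `|- v| < 1 by rewrite normrN.
have vK : cancel (boost_mom (- v)) (boost_mom v).
  by move=> p; rewrite -{1}[v]opprK boost_momK.
rewrite [RHS](@Rintegral_change_of_variables _ (boost_mom v) (boost_mom (- v))
  (fun p => p0 (boost_mom v p) / p0 p)
  (fun p => p0 (boost_mom (- v) p) / p0 p)).
- apply: eq_Rintegral => p _; have := p0_gt0 p; have := p0_gt0 (boost_mom v p).
  by move=> /lt0r_neq0 ? /lt0r_neq0 ?; field; apply/andP.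
- exact: boost_momK.
- by [].
- exact: boost_mom_lt.
- exact: cfactor.
- exact: cfactor.
- by [].
- by [].
- by move=> p; exact: is_derive_boost_mom.
- by move=> p; exact: is_derive_boost_mom.
Qed.

Lemma derivable_gam u : `|u| < 1 -> derivable (@gam R) u 1.
Proof.
move=> u1; have u0 := one_minus_sqr_gt0 u1.
apply: derivableV; first by rewrite gt_eqF// sqrtr_gt0.
apply/derivable1_diffP.
apply: (@differentiable_comp _ _ _ _ (fun u : R => 1 - u ^+ 2) Num.sqrt).
  by apply/derivable1_diffP.
by apply/derivable1_diffP; have [] := is_derive1_sqrt u0.
Qed.

Lemma derivable_energy u p : `|u| < 1 -> derivable (energy^~ p) u 1.
Proof.
move=> u1; apply: derivableB; last apply: derivableM => //.
  by apply: derivableM => //; exact: derivable_gam.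
by apply: derivableM => //; exact: derivable_gam.
Qed.

Lemma derivable_pbra u p : `|u| < 1 -> derivable (fun w => pbra w p / U0 w) u 1.
Proof.
move=> u1; apply: derivableM; last first.
  by apply: derivableV (derivable_gam u1); rewrite gt_eqF// gam_gt0.
apply: derivableD => //; apply: derivableM; last exact: derivable_energy.
by apply: derivableM => //; exact: derivable_gam.
Qed.

Lemma derivable1_comp (f g : R -> R) x :
  derivable f x 1 -> derivable g (f x) 1 -> derivable (g \o f) x 1.
Proof.
move=> /derivable1_diffP df /derivable1_diffP dg.
exact/derivable1_diffP/differentiable_comp.
Qed.

Lemma derivable_tP u theta s p : `|u| < 1 ->
  derivable (fun w => tP w theta s p) u 1.
Proof.
move=> u1; have de : derivable (energy^~ p) u 1 by exact: derivable_energy.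
have dexponent : derivable (fun w => - (theta^-1 * energy w p)) u 1.
  by apply: derivableN; apply: (derivableM _ de); exact: derivable_cst.
have dg : derivable (fun w => Defs.geq w theta p) u 1.
  apply: derivableM; first exact: derivable_cst.
  exact: (derivable1_comp dexponent (@derivable_expR _ _)).
have dP l k : derivable (fun w => (opoly l theta^-1 k).[energy w p]) u 1.
  exact: (derivable1_comp de (@derivable_horner _ _ _)).
rewrite /tP; case: (s.1 == 0%N); first exact: (derivableM dg (dP _ _)).
exact: (derivableM (derivableM dg (dP _ _)) (@derivable_pbra _ p u1)).
Qed.

Lemma is_derive_boost_vel u v : `|u| < 1 -> `|v| < 1 ->
  is_derive u 1 (boost_vel v) ((1 - v ^+ 2) / (1 - u * v) ^+ 2).
Proof.
move=> u1 v1; have uv0 : 1 - u * v != 0.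
  by rewrite gt_eqF// one_minus_mul_gt0.
have dd : is_derive u 1 (fun w : R => 1 - w * v) (- v).
  by apply: is_derive_eq; rewrite /GRing.scale/=; ring.
have dV := @is_deriveV _ (fun w => 1 - w * v) u _ _ uv0 dd.
apply: is_derive_eq; rewrite /GRing.scale/=; field.
by [].
Qed.

End Invariant.

(** * The distribution and the matrix D_M of a boosted state *)

Section System.
Context {R : realType} {M : nat}.
Implicit Types (u v p theta : R) (W X : 'cV[R]_(dimW M)).

Lemma val_inord1 : (0 < M)%N -> (inord 1 : 'I_(dimW M)) = 1%N :> nat.
Proof. by move=> M0; rewrite inordK//; case: M M0 => // m _; rewrite addSn. Qed.

(** A boost of the state and a variation of its velocity alone both stay within
    this relation, under which temperature, coefficients and source agree. *)
Definition agree_off_vel W (X : 'cV[R]_(dimW M)) :=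
  forall i : 'I_(dimW M), i != 1%N :> nat -> X i 0 = W i 0.

Lemma coord_agree W X k : agree_off_vel W X -> k != 1%N ->
  Defs.coord X k = Defs.coord W k.
Proof.
move=> WX k1; rewrite /Defs.coord; apply: WX.
by rewrite /inord /insubd; case: insubP => [i _ ->|_].
Qed.

Lemma coefs_agree W X : agree_off_vel W X -> coefs X = coefs W.
Proof.
move=> WX; rewrite /coefs /rho /temp /bulk /diffusion !(coord_agree WX)//.
case: ifP => // _; apply/matrixP => i j; rewrite !mxE.
have := WX i; case: (nat_of_ord i) => [|[|[|[|[|n]]]]] // ->//.
Qed.

Lemma agree_boost v W : agree_off_vel W (boost_state v W).
Proof. by move=> i /negbTE i1; rewrite mxE i1. Qed.

Lemma temp_boost v W : temp (boost_state v W) = temp W.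
Proof. exact: coord_agree (agree_boost v W) _. Qed.

Lemma coefs_boost v W : coefs (boost_state v W) = coefs W.
Proof. exact: coefs_agree (agree_boost v W). Qed.

Lemma vel_boost v W : (0 < M)%N ->
  vel (boost_state v W) = boost_vel v (vel W).
Proof.
by move=> M0; rewrite /vel /Defs.coord mxE val_inord1.
Qed.

(** The distribution as a function of the velocity alone, the coefficients
    and the temperature of [W] being kept. *)
Definition at_vel W p u : R := ((Defs.basis M u (temp W) p)^T *m coefs W) 0 0.

Lemma at_vel_boost v W p u : `|u| < 1 -> `|v| < 1 ->
  at_vel W (boost_mom v p) (boost_vel v u) = at_vel W p u.
Proof.
move=> u1 v1; rewrite /at_vel; congr ((_^T *m _) _ _).
by apply/matrixP => i j; rewrite !mxE tP_boost.
Qed.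

Lemma dist_boost v W p : (0 < M)%N -> `|vel W| < 1 -> `|v| < 1 ->
  dist (boost_state v W) (boost_mom v p) = dist W p.
Proof.
move=> M0 u1 v1; rewrite -[RHS](at_vel_boost W p u1 v1).
by rewrite /dist /at_vel vel_boost// coefs_boost temp_boost.
Qed.

Lemma derivable_at_vel W p u : `|u| < 1 -> derivable (at_vel W p) u 1.
Proof.
move=> u1; rewrite /at_vel.
have -> : (fun u => ((Defs.basis M u (temp W) p)^T *m coefs W) 0 0) =
    \sum_(i < dimW M) (fun u => tP u (temp W) (slot i) p * coefs W i 0).
  apply/funext => w; rewrite mxE fct_sumE.
  by apply: eq_bigr => i _; rewrite !mxE.
apply: derivable_sum => i; apply: derivableM => //.
exact: derivable_tP.
Qed.

(** The diagonal of the Jacobian matrix of the map W |-> W'. *)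
Definition jac v W : 'rV[R]_(dimW M) :=
  \row_j if j == 1%N :> nat then (1 - v ^+ 2) / (1 - vel W * v) ^+ 2 else 1.

Lemma jac_gt0 v W j : `|v| < 1 -> `|vel W| < 1 -> 0 < jac v W 0 j.
Proof.
move=> v1 u1; rewrite mxE; case: ifP => // _.
by rewrite divr_gt0 ?one_minus_sqr_gt0// exprn_gt0// one_minus_mul_gt0.
Qed.

Lemma derive_dist_vel W p (j : 'I_(dimW M)) : j = 1%N :> nat ->
  'D_(delta_mx j 0) (fun X : 'cV[R]_(dimW M) => dist X p) W =
  'D_1 (at_vel W p) (vel W).
Proof.
move=> j1.
suff quotE (h : R) : h^-1 *: (dist (h *: delta_mx j 0 + W) p - dist W p) =
    h^-1 *: (at_vel W p (h *: 1 + vel W) - at_vel W p (vel W)).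
  by apply: (congr1 (fun q : R -> R => lim (q h @[h --> 0^']))); apply/funext.
have ij : inord 1 = j by rewrite -j1; exact: (@inord_val (M + M)).
have WX : agree_off_vel W (h *: delta_mx j 0 + W).
  move=> i i1; rewrite !mxE; suff -> : (i == j) = false by rewrite mulr0 add0r.
  by apply/negP => /eqP/(congr1 val)/=; rewrite j1; exact/eqP.
rewrite /= /dist /at_vel (coefs_agree WX) /temp (coord_agree WX)//.
by rewrite /vel /Defs.coord ij !mxE !eqxx.
Qed.

(** The chain rule for F(W'; p') = F(W; p).  In the direction of the velocity it
    is that of one real variable; in the other directions, along which the
    velocity is fixed, the two difference quotients coincide, whether or not
    they converge. *)
Lemma derive_dist_boost v W p j : (0 < M)%N -> `|vel W| < 1 -> `|v| < 1 ->
  'D_(delta_mx j 0) (fun X : 'cV[R]_(dimW M) => dist X p) W =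
  jac v W 0 j * 'D_(delta_mx j 0)
    (fun X : 'cV[R]_(dimW M) => dist X (boost_mom v p)) (boost_state v W).
Proof.
move=> M0 u1 v1; rewrite mxE; case: ifP => [/eqP j1|j1].
  rewrite !derive_dist_vel// vel_boost//.
  have -> : at_vel (boost_state v W) = at_vel W.
    by rewrite /at_vel coefs_boost temp_boost.
  have e : \forall w \near vel W,
      (at_vel W (boost_mom v p) \o boost_vel v) w = at_vel W p w.
    have : \forall w \near vel W, `|w| < 1.
      exact: cvgr_lt (@norm_continuous _ R (vel W)) _ u1.
    by apply: filterS => w w1; exact: at_vel_boost.
  rewrite -(near_eq_derive _ e) -!derive1E derive1_comp; last 2 first.
  + by have [] := is_derive_boost_vel u1 v1.
  + exact/derivable_at_vel/boost_vel_lt1.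
  by rewrite mulrC !derive1E; have [_ ->] := is_derive_boost_vel u1 v1.
rewrite mul1r.
suff quotE (h : R) : h^-1 *: (dist (h *: delta_mx j 0 + W) p - dist W p) =
    h^-1 *: (dist (h *: delta_mx j 0 + boost_state v W) (boost_mom v p) -
             dist (boost_state v W) (boost_mom v p)).
  by apply: (congr1 (fun q : R -> R => lim (q h @[h --> 0^']))); apply/funext.
have velD : vel (h *: delta_mx j 0 + W) = vel W.
  rewrite /vel /Defs.coord !mxE; suff -> : (inord 1 == j) = false.
    by rewrite mulr0 add0r.
  by apply/negP => /eqP ij; move: j1; rewrite -ij val_inord1.
have bD : boost_state v (h *: delta_mx j 0 + W) =
    h *: delta_mx j 0 + boost_state v W.
  apply/matrixP => i k; rewrite (ord1 k) !mxE velD; case: ifP => // /eqP i1.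
  suff -> : (i == j) = false by rewrite mulr0 add0r.
  by apply/negP => /eqP ij; move: j1; rewrite -ij i1.
rewrite -(dist_boost p M0 u1 v1) -(@dist_boost v (h *: delta_mx j 0 + W) p)//.
  by rewrite bD.
by rewrite velD.
Qed.

(** The chain rule integrated against the basis functions; the measure dp / p^0
    and the weights are invariant. *)
Lemma Dmx_boost v W : (0 < M)%N -> `|vel W| < 1 -> `|v| < 1 ->
  Dmx W = Dmx (boost_state v W) *m diag_mx (jac v W).
Proof.
move=> M0 u1 v1; apply/matrixP => k j; rewrite mul_mx_diag [LHS]mxE [RHS]mxE.
rewrite [Dmx _ _ _]mxE /inner mulrC -(Rintegral_scale _ (jac_gt0 j v1 u1)).
under [RHS]eq_Rintegral do rewrite !mulrA.
rewrite -[RHS](Rintegral_boost _ v1).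
apply: eq_Rintegral => p _.
rewrite (derive_dist_boost _ _ M0 u1 v1).
rewrite ![Defs.basis _ _ _ _ _ _]mxE vel_boost// temp_boost.
by rewrite tP_boost// geq_boost.
Qed.
End System.

(** * Covariance of the system *)

Section Covariance.
Context {R : realType}.

Lemma boostK (v : R) : `|v| < 1 -> cancel (boost v) (boost (- v)).
Proof.
move=> v1 [t x]; rewrite /boost /= gamN; have g := sqr_mul_gam v1.
by congr pair; ring: g.
Qed.

Lemma is_diff_linear (V U : normedModType R) (f : V -> U) x :
  linear f -> continuous f -> is_diff x f f.
Proof.
move=> lf cf.
pose fM := GRing.isLinear.Build _ _ _ _ f lf.
pose fL : {linear V -> U} := HB.pack f fM.
rewrite -[f]/(fL : V -> U); apply: DiffDef.
  exact: linear_differentiable.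
exact: diff_lin.
Qed.

Lemma is_derive_is_diff (f : R -> R) (x a : R) :
  is_derive x 1 f a -> is_diff x f (fun h => a * h).
Proof.
move=> [/derivable1_diffP df dfE]; apply: DiffDef => //.
apply/funext => h; rewrite -[X in 'd _ _ X]mulr1 [LHS]linearZ.
by rewrite -deriveE// dfE; exact: mulrC.
Qed.

Lemma near_eq_differentiable (V U : normedModType R) (f g : V -> U) a :
  (\forall x \near a, f x = g x) -> differentiable f a -> differentiable g a.
Proof.
move=> fg df.
have gE : g \o shift a = cst (g a) + 'd f a +o_ 0 id.
  apply/eqaddoP => e e0; move/eqaddoP: (diff_locally df) => /(_ e e0).
  have fg0 : \forall h \near (0 : V), f (h + a) = g (h + a).
    move: fg; rewrite (near_shift 0 a); apply: filterS => h.
    by rewrite /= subr0.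
  apply: filterS2 fg0 => h /= fgh.
  by rewrite /= !fctE /= fgh (nbhs_singleton fg).
have cd := diff_continuous df.
by apply/diff_locallyP; rewrite (diff_unique cd gE).
Qed.

Lemma differentiable_boost (v : R) y : differentiable (boost v) y.
Proof.
have [d1 _] : is_diff y (fst : R * R -> R) fst.
  by apply: is_diff_linear => // z; exact: cvg_fst.
have [d2 _] : is_diff y (snd : R * R -> R) snd.
  by apply: is_diff_linear => // z; exact: cvg_snd.
by apply: differentiable_pair; apply: differentiableM => //;
  apply: differentiableB => //; apply: differentiableM.
Qed.

Lemma boost_lin (v h : R) w y :
  boost v (h *: w + y) = h *: boost v w + boost v y.
Proof.
by rewrite /boost /=; congr pair; rewrite /= /GRing.scale/=; ring.
Qed.

(** The boost being linear, both sides are limits of the same quotients. *)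
Lemma derive_comp_boost {V : normedModType R} (f : R * R -> V) v w y :
  'D_w (f \o boost v) y = 'D_(boost v w) f (boost v y).
Proof.
apply: (congr1 (fun q : R -> V => lim (q h @[h --> 0^']))).
by apply/funext => h /=; rewrite boost_lin.
Qed.

Section State.
Variable M : nat.
Implicit Types W X : 'cV[R]_(dimW M).

Lemma eq_inord1 (i : 'I_(dimW M)) : (0 < M)%N ->
  (i == inord 1) = (i == 1%N :> nat).
Proof. by move=> M0; rewrite -val_eqE /= val_inord1. Qed.

Lemma velE W (i : 'I_(dimW M)) : i = 1%N :> nat -> vel W = W i 0.
Proof.
move=> i1; rewrite /vel /Defs.coord; congr (W _ _).
by rewrite -i1; exact: (@inord_val (M + M)).
Qed.

Lemma boost_stateE v W : (0 < M)%N -> boost_state v W =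
  W + (boost_vel v (vel W) - vel W) *: delta_mx (inord 1) 0.
Proof.
move=> M0; apply/matrixP => i j; rewrite (ord1 j) !mxE andbT.
rewrite eq_inord1//.
have [i1|_] := eqVneq (nat_of_ord i) 1%N; last by rewrite mulr0 addr0.
by rewrite mulr1 -(velE W i1) addrC subrK.
Qed.

Lemma is_diff_boost_state v W : (0 < M)%N -> `|vel W| < 1 -> `|v| < 1 ->
  is_diff W (boost_state v) (fun X => diag_mx (jac v W) *m X).
Proof.
move=> M0 u1 v1.
have dvel : is_diff W (@vel R M) (@vel R M).
  apply: is_diff_linear; last exact: coord_continuous.
  by move=> a X Y; rewrite /vel /Defs.coord !mxE.
have dbv := is_derive_is_diff (is_derive_boost_vel u1 v1).
have [dshift shiftE] := is_diffB (is_diff_comp dvel dbv) dvel.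
have dZ := differentiableZl (delta_mx (inord 1) 0 : 'cV[R]_(dimW M)) dshift.
have [dsum sumE] := is_diffD (is_diff_id W) (differentiableP dZ).
have -> : boost_state v = id + (fun X =>
    (boost_vel v \o @vel R M - @vel R M) X *: delta_mx (inord 1) 0).
  by apply/funext => X; rewrite boost_stateE.
apply: DiffDef; first exact: dsum.
rewrite sumE diffZl; last exact: dshift.
rewrite shiftE; apply/funext => X; rewrite mul_diag_mx.
apply/matrixP => i j; rewrite (ord1 j) !mxE andbT eq_inord1//.
have [i1|_] := eqVneq (nat_of_ord i) 1%N; last by rewrite mulr0 addr0 mul1r.
by rewrite /= -(velE X i1) !fctE; ring.
Qed.

End State.

(** The field W', as a function of the boosted coordinates, is the composite of
    the boost of states, [W] and the inverse boost of space-time. *)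
Lemma derive_boosted_field (M : nat) (v : R) (W : R * R -> 'cV[R]_(dimW M)) y :
  (0 < M)%N -> `|vel (W y)| < 1 -> `|v| < 1 -> differentiable W y ->
  let V := boost_state v \o W \o boost (- v) in
  differentiable V (boost v y) /\
  forall w,
    'D_w V (boost v y) = diag_mx (jac v (W y)) *m 'd W y (boost (- v) w).
Proof.
move=> M0 u1 v1 dW V.
have yK : boost (- v) (boost v y) = y by exact: boostK.
have [dSW dSWE] :=
  is_diff_comp (differentiableP dW) (is_diff_boost_state M0 u1 v1).
split=> [|w].
  apply: (@differentiable_comp _ _ _ _ (boost (- v)) (boost_state v \o W)).
    exact: differentiable_boost.
  by rewrite yK.
rewrite /V derive_comp_boost yK deriveE; last exact: dSW.
have dSWwE := congr1 (@^~ (boost (- v) w)) dSWE.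
exact: dSWwE.
Qed.

Lemma mulmx_comb m n p q (a b : R) (P : 'M[R]_(m, n)) (X Y : 'M[R]_(n, p))
    (Q : 'M[R]_(p, q)) :
  a *: (P *m X *m Q) + b *: (P *m Y *m Q) = P *m (a *: X + b *: Y) *m Q.
Proof. by rewrite mulmxDr mulmxDl -!scalemxAr -!scalemxAl. Qed.

(** The algebra of the covariance: the boost mixes the two derivatives and the
    two matrices with the same symmetric coefficients, and [D'] absorbs the
    Jacobian [J]. *)
Lemma mulmx_boosted_frame m (T X T' X' D D' J : 'M[R]_m) (a b : 'cV[R]_m)
    (g h : R) :
  D = D' *m J -> g *: T' + h *: X' = T -> h *: T' + g *: X' = X ->
  T' *m D' *m (J *m (g *: a + h *: b)) + X' *m D' *m (J *m (h *: a + g *: b)) =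
  T *m D *m a + X *m D *m b.
Proof.
move=> -> <- <-; rewrite !(mulmxDr, mulmxDl) -!scalemxAr -!scalemxAl !mulmxA.
by rewrite addrACA.
Qed.

(** The coefficients of A^0 and A^1 in M^t and M^x are, up to sign, components
    of the two-velocity of the fluid, which is boosted by [v]; combining them as
    in the inverse boost undoes this. *)
Lemma covariant_Mt (M : nat) (v : R) (W : 'cV[R]_(dimW M)) :
  (0 < M)%N -> `|vel W| < 1 -> `|v| < 1 ->
  gam v *: Mt (boost_state v W) + (gam v * v) *: Mx (boost_state v W) = Mt W.
Proof.
move=> M0 u1 v1; rewrite /Mt /Mx vel_boost// temp_boost.
rewrite mulmx_comb; congr (_ *m _ *m _).
rewrite !scalerBr !scalerA addrACA -opprD -!scalerDl.
have uv0 : 1 - vel W * v != 0 by rewrite gt_eqF// one_minus_mul_gt0.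
congr (_ *: _ - _ *: _); rewrite /U1 /U0 gam_boost_vel// /boost_vel.
  transitivity (gam (vel W) * (gam v ^+ 2 * (1 - v ^+ 2))); first by field.
  by rewrite gam_sqr// mulr1.
transitivity (vel W * gam (vel W) * (gam v ^+ 2 * (1 - v ^+ 2))).
  by field.
by rewrite gam_sqr// mulr1.
Qed.

Lemma covariant_Mx (M : nat) (v : R) (W : 'cV[R]_(dimW M)) :
  (0 < M)%N -> `|vel W| < 1 -> `|v| < 1 ->
  (gam v * v) *: Mt (boost_state v W) + gam v *: Mx (boost_state v W) = Mx W.
Proof.
move=> M0 u1 v1; rewrite /Mt /Mx vel_boost// temp_boost.
rewrite mulmx_comb; congr (_ *m _ *m _).
rewrite !scalerBr !scalerA addrACA -opprD -!scalerDl.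
have uv0 : 1 - vel W * v != 0 by rewrite gt_eqF// one_minus_mul_gt0.
congr (_ *: _ - _ *: _); rewrite /U1 /U0 gam_boost_vel// /boost_vel.
  transitivity (vel W * gam (vel W) * (gam v ^+ 2 * (1 - v ^+ 2))).
    by field.
  by rewrite gam_sqr// mulr1.
transitivity (gam (vel W) * (gam v ^+ 2 * (1 - v ^+ 2))); first by field.
by rewrite gam_sqr// mulr1.
Qed.

Lemma source_boost (M : nat) tau (v : R) (W : 'cV[R]_(dimW M)) :
  source tau (boost_state v W) = source tau W.
Proof.
have WX := agree_boost v W.
rewrite /source (coefs_agree WX) /coefs_eq /rho /temp.
by rewrite !(coord_agree WX).
Qed.

End Covariance.

Theorem theorem5p5 (R : realType) (M : nat) (hM : (1 <= M)%N)
    (tau : R -> R -> R)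
    (htau : forall r theta : R, 0 < r -> 0 < theta -> 0 < tau r theta)
    (v : R) (hv : -1 < v < 1)
    (Omega : set (R * R)) (W : R * R -> 'cV[R]_(dimW M))
    (hW : solution tau Omega W)
    (W' : R * R -> 'cV[R]_(dimW M))
    (hW' : forall y : R * R, Omega y -> W' (boost v y) = boost_state v (W y)) :
  solution tau (boost v @` Omega) W'.
Proof.
have v1 : `|v| < 1 by rewrite ltr_norml.
have [oO sol] := hW.
have bK z : boost v (boost (- v) z) = z.
  by rewrite -{1}[v]opprK boostK// normrN.
have imE : boost v @` Omega = boost (- v) @^-1` Omega.
  apply/seteqP; split=> [_ [y Oy <-]|z Oz]/=; first by rewrite boostK.
  by exists (boost (- v) z).
have oI : open (boost v @` Omega).
  rewrite imE; apply: open_comp => // z _.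
  exact/differentiable_continuous/differentiable_boost.
split=> // _ [y Oy <-].
have [[rho0 u1 th0] dW eqW] := sol y Oy.
have WX := agree_boost v (W y).
have [dV DV] := derive_boosted_field hM u1 v1 dW.
set V := (_ \o _) in dV DV.
(* The transformed field is only prescribed on the image of [Omega], which is
   a neighbourhood of the point considered. *)
have VW' : \forall z \near boost v y, V z = W' z.
  have : \forall z \near boost v y, (boost v @` Omega) z.
    by apply: open_nbhs_nbhs; split => //; exists y.
  by apply: filterS => _ [x Ox <-]; rewrite hW'// /V/= boostK.
split.
- rewrite hW'//; split; rewrite /rho /temp ?(coord_agree WX)//.
  by rewrite vel_boost// boost_vel_lt1.
- exact: near_eq_differentiable VW' dV.
have DW' w : 'D_w W' (boost v y) =
    diag_mx (jac v (W y)) *m 'd W y (boost (- v) w).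
  by rewrite -DV; exact/esym/near_eq_derive.
(* The boosts of the coordinate vectors express the derivatives in (t', x')
   by those in (t, x). *)
have tE : boost (- v) (1, 0) = gam v *: (1, 0) + (gam v * v) *: (0, 1) :> R * R.
  rewrite /boost /= gamN; congr pair; rewrite /= /GRing.scale/=.
    by rewrite !(mulr0, mulr1) subr0 addr0 mulr1.
  by rewrite !(mulr0, mulr1) sub0r opprK add0r.
have xE : boost (- v) (0, 1) = (gam v * v) *: (1, 0) + gam v *: (0, 1) :> R * R.
  rewrite /boost /= gamN; congr pair; rewrite /= /GRing.scale/=.
    by rewrite !(mulr0, mulr1) sub0r opprK addr0.
  by rewrite !(mulr0, mulr1) subr0 add0r mulr1.
have dlin (c d : R) : 'd W y (c *: (1, 0) + d *: (0, 1)) =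
    c *: 'D_(1, 0) W y + d *: 'D_(0, 1) W y.
  by rewrite (deriveE _ dW) (deriveE _ dW) linearD !linearZ.
rewrite !DW' tE xE !dlin (hW' y Oy) source_boost -eqW.
exact: mulmx_boosted_frame (Dmx_boost hM u1 v1)
  (covariant_Mt hM u1 v1) (covariant_Mx hM u1 v1).
Qed.
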